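(* The Rota--Baxter subalgebra $\mathcal{R}$ of $A$ generated by $X$ is a free (noncommutative, weight one) Rota--Baxter algebra on one generator. More generally, for every $n\ge 1$, the Rota--Baxter subalgebra $\mathcal{R}^{(n)}$ of $A^{(n)}$ generated by $X^1,\ldots,X^n$ is a free Rota--Baxter algebra on $n$ generators.
   Context: The ground field $\mathbb{K}$ has characteristic zero. A Rota--Baxter (RB) algebra of weight one is an associative, not necessarily unital nor commutative, $\mathbb{K}$-algebra $B$ with a linear map $R:B\to B$ such that $R(a)R(b)=R(R(a)b+aR(b)+ab)$; morphisms are (not necessarily unital) algebra maps commuting with $R$, and the free RB algebra on a set of generators is the free object in this category. The RB subalgebra generated by a set is the smallest (not necessarily unital) subalgebra containing it and stable under $R$. Let $X=(x_1,x_2,\dots)$ be a sequence of noncommuting variables, and for $1\le i\le n$ let $X^i=(x_1^i,x_2^i,\dots)$ be disjoint such alphabets. $T(X)$, resp. $T(X^1,\dots,X^n)$, is the free associative $\mathbb{K}$-algebra on $X$, resp. on $X^1\sqcup\cdots\sqcup X^n$. $A$ (resp. $A^{(n)}$) is the algebra of sequences $(y_1,y_2,\dots)$ of elements of $T(X)$ (resp. $T(X^1,\dots,X^n)$) with componentwise sum and product, equipped with the weight one Rota--Baxter operator $$R(y_1,y_2,\dots):=(0,y_1,y_1+y_2,\dots,y_1+\cdots+y_k,\dots).$$ $X$ (resp. $X^i$) is viewed as the element $(x_1,x_2,\dots)$ of $A$ (resp. $(x_1^i,x_2^i,\dots)$ of $A^{(n)}$). *)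

(* Defs.v *)
From HB Require Import structures.
From mathcomp Require Import all_boot all_algebra.
From mathcomp Require Import boolp classical_sets functions.
From mathcomp Require finmap.
From mathcomp Require Import monalg.

Set Implicit Arguments.
Unset Strict Implicit.
Unset Printing Implicit Defensive.

Import GRing.Theory.
Local Open Scope ring_scope.
Local Open Scope classical_set_scope.

(* The algebras of ssralg are unital, hence this separate hierarchy for       *)
(* associative algebras without a unit.                                       *)
HB.mixin Record Lmodule_isAssocAlgebra (K : fieldType) B of GRing.Lmodule K B := {
  amul : B -> B -> B;
  amulA : associative amul;
  amulDl : left_distributive amul +%R;
  amulDr : right_distributive amul +%R;
  amulZl : forall (c : K) (a b : B), amul (c *: a) b = c *: amul a b;
  amulZr : forall (c : K) (a b : B), amul a (c *: b) = c *: amul a b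
}.

#[short(type="assocAlgType")]
HB.structure Definition AssocAlgebra (K : fieldType) :=
  {B of Lmodule_isAssocAlgebra K B & GRing.Lmodule K B}.

Declare Scope assoc_scope.
Delimit Scope assoc_scope with A.
Notation "a ** b" := (amul a b)
  (at level 40, left associativity) : assoc_scope.
Local Open Scope assoc_scope.

HB.mixin Record AssocAlgebra_isRotaBaxter (K : fieldType) B
    of AssocAlgebra K B := {
  rbop : B -> B;
  rbop_linear : linear rbop;
  rbopM : forall a b : B,
    rbop a ** rbop b = rbop (rbop a ** b + a ** rbop b + a ** b)
}.

(* Rota-Baxter algebras of weight one. *)
#[short(type="rbAlgType")]
HB.structure Definition RotaBaxter (K : fieldType) :=
  {B of AssocAlgebra_isRotaBaxter K B & AssocAlgebra K B}.

Definition rb_morphism (K : fieldType) (B C : rbAlgType K) (f : B -> C) : Prop :=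
  [/\ linear f,
      {morph f : a b / a ** b} &
      {morph f : a / rbop a}].

Definition rb_free (K : fieldType) (F : rbAlgType K) (I : Type)
    (gen : I -> F) : Prop :=
  forall (B : rbAlgType K) (b : I -> B),
    exists! f : F -> B, rb_morphism f /\ (forall i, f (gen i) = b i).

Definition rb_closed (K : fieldType) (B : rbAlgType K) (S : set B) : Prop :=
  [/\ S 0,
      forall (c : K) (a b : B), S a -> S b -> S (c *: a + b),
      forall a b : B, S a -> S b -> S (a ** b) &
      forall a : B, S a -> S (rbop a)].

Definition rb_generated (K : fieldType) (B : rbAlgType K) (G : set B) : set B :=
  smallest (@rb_closed K B) G.

Lemma rb_generated_closed (K : fieldType) (B : rbAlgType K) (G : set B) :
  rb_closed (rb_generated G).
Proof.
split=> [|c a b Sa Sb|a b Sa Sb|a Sa] M [CM GM]; case: (CM) => S0 SL SM SR //.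
- by apply: SL; [exact: Sa | exact: Sb].
- by apply: SM; [exact: Sa | exact: Sb].
- by apply: SR; exact: Sa.
Qed.

Definition rb_subalg (K : fieldType) (B : rbAlgType K) (I : Type)
    (x : I -> B) : Type :=
  {a : B | a \in rb_generated (range x)}.

Section RBSubalg.
Variables (K : fieldType) (B : rbAlgType K) (I : Type) (x : I -> B).

Local Notation T := (rb_subalg x).
Local Notation S := (rb_generated (range x)).

HB.instance Definition _ := SubChoice.copy T {a : B | a \in S}.

Lemma rb_subalg_submod_closed : subsemimod_closed (fun a : B => a \in S).
Proof.
have [S0 SL _ _] := rb_generated_closed (range x).
split; [split|].
- exact/mem_set.
- move=> a b /set_mem Sa /set_mem Sb; apply/mem_set.
  by rewrite -[a]scale1r; exact: SL.
- move=> c a /set_mem Sa; apply/mem_set.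
  by rewrite -[c *: a]addr0; exact: SL.
Qed.

HB.instance Definition _ := GRing.SubChoice_isSubLmodule.Build K B
  (fun a : B => a \in S) T rb_subalg_submod_closed.

Lemma rb_subalg_mul_subproof (u v : T) : \val u ** \val v \in S.
Proof.
have [_ _ SM _] := rb_generated_closed (range x).
by apply/mem_set; apply: SM; apply: set_mem; exact: valP.
Qed.

Lemma rb_subalg_op_subproof (u : T) : rbop (\val u) \in S.
Proof.
have [_ _ _ SR] := rb_generated_closed (range x).
by apply/mem_set; apply: SR; apply: set_mem; exact: valP.
Qed.

Definition rb_subalg_mul (u v : T) : T :=
  exist _ (\val u ** \val v) (rb_subalg_mul_subproof u v).
Definition rb_subalg_op (u : T) : T :=
  exist _ (rbop (\val u)) (rb_subalg_op_subproof u).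

Local Notation valT := (\val : T -> B).

Let valD (u v : T) : valT (u + v) = valT u + valT v. Proof. exact: raddfD. Qed.

Let valZ (c : K) (u : T) : valT (c *: u) = c *: valT u. Proof. exact: linearZ. Qed.

Let valM (u v : T) : valT (rb_subalg_mul u v) = valT u ** valT v. Proof. by []. Qed.

Let valR (u : T) : valT (rb_subalg_op u) = rbop (valT u). Proof. by []. Qed.

Lemma rb_subalg_mulA : associative rb_subalg_mul.
Proof. by move=> u v w; apply/val_inj; rewrite !valM amulA. Qed.

Lemma rb_subalg_mulDl : left_distributive rb_subalg_mul +%R.
Proof. by move=> u v w; apply/val_inj; rewrite valD !valM valD amulDl. Qed.

Lemma rb_subalg_mulDr : right_distributive rb_subalg_mul +%R.
Proof. by move=> u v w; apply/val_inj; rewrite valD !valM valD amulDr. Qed.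

Lemma rb_subalg_mulZl (c : K) (u v : T) :
  rb_subalg_mul (c *: u) v = c *: rb_subalg_mul u v.
Proof. by apply/val_inj; rewrite valZ !valM valZ amulZl. Qed.

Lemma rb_subalg_mulZr (c : K) (u v : T) :
  rb_subalg_mul u (c *: v) = c *: rb_subalg_mul u v.
Proof. by apply/val_inj; rewrite valZ !valM valZ amulZr. Qed.

HB.instance Definition _ := Lmodule_isAssocAlgebra.Build K T
  rb_subalg_mulA rb_subalg_mulDl rb_subalg_mulDr
  rb_subalg_mulZl rb_subalg_mulZr.

Lemma rb_subalg_op_linear : linear rb_subalg_op.
Proof. by move=> c u v; apply/val_inj; rewrite valD valZ !valR valD valZ rbop_linear. Qed.

Lemma rb_subalg_opM (u v : T) :
  rb_subalg_op u ** rb_subalg_op v =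
  rb_subalg_op (rb_subalg_op u ** v + u ** rb_subalg_op v + u ** v).
Proof. by apply/val_inj; rewrite valM !valR rbopM !valD !valM !valR. Qed.

HB.instance Definition _ := AssocAlgebra_isRotaBaxter.Build K T
  rb_subalg_op_linear rb_subalg_opM.

Lemma rb_subalg_gen_subproof (i : I) : x i \in S.
Proof. by apply/mem_set; apply: sub_gen_smallest; exists i. Qed.

Definition rb_subalg_gen (i : I) : T :=
  exist _ (x i) (rb_subalg_gen_subproof i).

End RBSubalg.

(* Sequences (y_1, y_2, ...) are indexed from 0: [y k] stands for y_(k+1). *)
Definition rbseq (K : fieldType) (T : algType K) : Type := nat -> T.

Section RBSeq.
Variables (K : fieldType) (T : algType K).

HB.instance Definition _ := GRing.Lmodule.copy (rbseq T) (nat -> T).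

Definition rbseq_mul (y z : rbseq T) : rbseq T := fun k => y k * z k.

Definition rbseq_op (y : rbseq T) : rbseq T := fun k => \sum_(i < k) y i.

Lemma rbseq_mulA : associative rbseq_mul.
Proof. by move=> u v w; apply/funext => k; exact: mulrA. Qed.

Lemma rbseq_mulDl : left_distributive rbseq_mul +%R.
Proof. by move=> u v w; apply/funext => k; exact: mulrDl. Qed.

Lemma rbseq_mulDr : right_distributive rbseq_mul +%R.
Proof. by move=> u v w; apply/funext => k; exact: mulrDr. Qed.

Lemma rbseq_mulZl (c : K) (u v : rbseq T) :
  rbseq_mul (c *: u) v = c *: rbseq_mul u v.
Proof. by apply/funext => k; rewrite /rbseq_mul /= -scalerAl. Qed.

Lemma rbseq_mulZr (c : K) (u v : rbseq T) :
  rbseq_mul u (c *: v) = c *: rbseq_mul u v.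
Proof. by apply/funext => k; rewrite /rbseq_mul /= -scalerAr. Qed.

HB.instance Definition _ := Lmodule_isAssocAlgebra.Build K (rbseq T)
  rbseq_mulA rbseq_mulDl rbseq_mulDr rbseq_mulZl rbseq_mulZr.

Lemma rbseq_op_linear : linear rbseq_op.
Proof.
move=> c u v; apply/funext => k.
transitivity (\sum_(i < k) (c *: u i + v i)) => //.
by rewrite big_split /= -scaler_sumr.
Qed.

Lemma rbseq_opM (u v : rbseq T) :
  rbseq_op u ** rbseq_op v =
  rbseq_op (rbseq_op u ** v + u ** rbseq_op v + u ** v).
Proof.
apply/funext; elim=> [|k IHk].
  by rewrite /amul /= /rbseq_mul /rbseq_op !big_ord0 mul0r.
move: IHk; rewrite /amul /= /rbseq_mul /rbseq_op => IHk.
rewrite !big_ord_recr /= -IHk.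
by rewrite mulrDl !mulrDr -!addrA; congr (_ + _).
Qed.

HB.instance Definition _ := AssocAlgebra_isRotaBaxter.Build K (rbseq T)
  rbseq_op_linear rbseq_opM.

End RBSeq.

(* The free associative algebra over an alphabet V: [monalg] only provides    *)
(* its left algebra structure.                                                *)
Definition freealg (K : fieldType) (V : choiceType) : Type :=
  {malg K[{fmonom V}]}.

HB.instance Definition _ (K : fieldType) (V : choiceType) :=
  GRing.Lalgebra.copy (freealg K V) {malg K[{fmonom V}]}.

Lemma freealg_scaleAr (K : fieldType) (V : choiceType) (c : K)
  (g h : freealg K V) : c *: (g * h) = g * (c *: h).
Proof.
apply/malgP => k; rewrite mcoeffZ mcoeffMl.
rewrite (mcoeffMlw k (finmap.fsubset_refl _) (msuppZ_le c h)) mulr_sumr.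
apply: eq_bigr => k1 _; rewrite mulr_sumr; apply: eq_bigr => k2 _.
by rewrite mcoeffZ mulrnAr mulrCA.
Qed.

HB.instance Definition _ (K : fieldType) (V : choiceType) :=
  GRing.Lalgebra_isAlgebra.Build K (freealg K V) (@freealg_scaleAr K V).

Definition freealg_var (K : fieldType) (V : choiceType) (v : V) : freealg K V :=
  << fmu v >>.

Definition alphabet (K : fieldType) : rbseq (freealg K nat) :=
  fun k => freealg_var K k.

(* The pair (i, k) encodes the letter x^i_(k+1) of the alphabet X^i.          *)
Definition alphabets (K : fieldType) (n : nat) (i : 'I_n) :
    rbseq (freealg K ('I_n * nat)%type) :=
  fun k => freealg_var K (i, k).

(* Main.v *)
(* The words in the generators and in symbols R(u) with no two adjacent
   factors R(u)R(v) span every Rota-Baxter algebra generated by the given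
   elements, because the Rota-Baxter relation rewrites R(u)R(v) as R of shorter
   products. It remains to see that these normal words have linearly independent
   values in the algebra of sequences; the graph of a morphism to B is then the
   subalgebra of the product with B generated by the pairs of generators.

   At level k a word evaluates to a sum of monomials, one for each way of
   labelling its letters by indices at most k decreasing strictly along nested
   R's. The pointwise largest labelling gives a monomial of coefficient 1 that
   strictly dominates all others in total index, and a normal word can be read
   off from it: the letters of index k are those outside every R, and the blocks
   between them are the contents of the R's, at level k - 1. Hence the matrix of
   coefficients is unitriangular, in any characteristic. *)

Require Import Defs.
From HB Require Import structures.
From mathcomp Require Import all_boot all_algebra.
From mathcomp Require Import boolp classical_sets.
From mathcomp Require Import monalg.
From mathcomp Require Import zify.

Set Implicit Arguments.
Unset Strict Implicit.
Unset Printing Implicit Defensive.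

Import GRing.Theory.
Local Open Scope ring_scope.
Local Open Scope classical_set_scope.
Local Open Scope assoc_scope.

(** * Linear spans of families of vectors *)

Lemma linear_pred0 (K : fieldType) (M N : lmodType K) (f : M -> N) :
  linear f -> f 0 = 0.
Proof.
by move=> /(_ (-1) 0 0); rewrite !scaleN1r oppr0 addr0 addNr.
Qed.

Section LinearSpan.
Variables (K : fieldType) (M : lmodType K).

Inductive lspan (W : Type) (Q : W -> Prop) (e : W -> M) : M -> Prop :=
| lspan0 : lspan Q e 0
| lspanZD c w a : Q w -> lspan Q e a -> lspan Q e (c *: e w + a).

Variables (W : Type) (e : W -> M).

Lemma lspanZ Q c a : lspan Q e a -> lspan Q e (c *: a).
Proof.
elim=> [|d w {}a Qw _ IH]; first by rewrite scaler0; exact: lspan0.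
by rewrite scalerDr scalerA; exact: lspanZD.
Qed.

Lemma lspanD Q a b : lspan Q e a -> lspan Q e b -> lspan Q e (a + b).
Proof.
elim=> [|d w {}a Qw _ IH] Sb; first by rewrite add0r.
by rewrite -addrA; apply: lspanZD => //; exact: IH.
Qed.

Lemma lspan_gen (Q : W -> Prop) w : Q w -> lspan Q e (e w).
Proof.
by move=> Qw; rewrite -[e w]scale1r -[_ *: _]addr0; apply: lspanZD => //;
  exact: lspan0.
Qed.

Lemma lspanS (Q Q' : W -> Prop) a :
  (forall w, Q w -> Q' w) -> lspan Q e a -> lspan Q' e a.
Proof.
by move=> QQ'; elim=> [|c w {}a Qw _ IH]; [exact: lspan0 |
  apply: lspanZD => //; exact: QQ'].
Qed.

End LinearSpan.

Lemma lspan_map (K : fieldType) (M N : lmodType K) (W W' : Type)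
    (Q : W -> Prop) (e : W -> M) (Q' : W' -> Prop) (e' : W' -> N)
    (f : M -> N) a :
  linear f -> (forall w, Q w -> lspan Q' e' (f (e w))) ->
  lspan Q e a -> lspan Q' e' (f a).
Proof.
move=> lin_f Sf; elim=> [|c w {}a Qw _ IH].
  by rewrite linear_pred0 //; exact: lspan0.
by rewrite lin_f; apply: lspanD => //; apply: lspanZ; exact: Sf.
Qed.

(** The inductive span allows the same index to occur repeatedly; coefficients are merged here so
    that linear independence, stated for duplicate-free lists, applies. *)
Lemma lspan_sum (K : fieldType) (M : lmodType K) (W : eqType) (Q : W -> Prop)
    (e : W -> M) a :
  lspan Q e a ->
  exists (s : seq W) (c : W -> K),
    [/\ uniq s, {in s, forall w, Q w} & a = \sum_(w <- s) c w *: e w].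
Proof.
elim=> [|d v {}a Qv _ [s [c [us Qs ->]]]].
  by exists [::], (fun=> 0); rewrite big_nil.
have [vs|vs] := boolP (v \in s).
  exists s, (fun w => (if w == v then d else 0) + c w); split=> //.
  under [RHS]eq_bigr do rewrite scalerDl.
  rewrite big_split /=; congr (_ + _).
  rewrite (bigD1_seq v) //= eqxx [X in _ + X]big1 ?addr0 // => w /negPf ->.
  by rewrite scale0r.
exists (v :: s), (fun w => if w == v then d else c w); split=> /=.
- by rewrite vs.
- by move=> w; rewrite inE => /predU1P[-> //|/Qs].
rewrite big_cons eqxx; congr (_ + _); rewrite !big_seq; apply: eq_bigr => w ws.
by rewrite (negPf (memPn vs _ ws)).
Qed.

(** * The product of two Rota-Baxter algebras *)

Section ProductAlgebra.
Variables (K : fieldType) (A B : rbAlgType K).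

Definition pair_amul (u v : A * B) : A * B := (u.1 ** v.1, u.2 ** v.2).
Definition pair_rbop (u : A * B) : A * B := (rbop u.1, rbop u.2).

Lemma pair_amulA : associative pair_amul.
Proof. by move=> u v w; rewrite /pair_amul /= !amulA. Qed.

Lemma pair_amulDl : left_distributive pair_amul +%R.
Proof. by move=> u v w; rewrite /pair_amul /= !amulDl. Qed.

Lemma pair_amulDr : right_distributive pair_amul +%R.
Proof. by move=> u v w; rewrite /pair_amul /= !amulDr. Qed.

Lemma pair_amulZl c (u v : A * B) : pair_amul (c *: u) v = c *: pair_amul u v.
Proof. by rewrite /pair_amul /= !amulZl. Qed.

Lemma pair_amulZr c (u v : A * B) : pair_amul u (c *: v) = c *: pair_amul u v.
Proof. by rewrite /pair_amul /= !amulZr. Qed.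

HB.instance Definition _ := Lmodule_isAssocAlgebra.Build K (A * B)%type
  pair_amulA pair_amulDl pair_amulDr pair_amulZl pair_amulZr.

Lemma pair_rbop_linear : linear pair_rbop.
Proof. by move=> c u v; rewrite /pair_rbop /= !rbop_linear. Qed.

Lemma pair_rbopM (u v : A * B) :
  pair_rbop u ** pair_rbop v =
  pair_rbop (pair_rbop u ** v + u ** pair_rbop v + u ** v).
Proof. by rewrite /amul /= /pair_amul /= !rbopM. Qed.

HB.instance Definition _ := AssocAlgebra_isRotaBaxter.Build K (A * B)%type
  pair_rbop_linear pair_rbopM.

Lemma rb_morphism_fst : rb_morphism (fst : A * B -> A).
Proof. by []. Qed.

End ProductAlgebra.

(* [OpMul u w] stands for the word R(u)w. *)
Inductive rbword (I : Type) : Type :=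
| Gen of I
| GenMul of I & rbword I
| Op of rbword I
| OpMul of rbword I & rbword I.

(** Classical equality: [I] is an arbitrary type, yet finite families of words need [uniq] and
    membership. *)
HB.instance Definition _ (I : Type) := gen_eqMixin (rbword I).

(** * Normal words and their spanning property *)

Section Words.
Variable I : Type.
Implicit Types u v w : rbword I.

Definition starts_gen w : bool :=
  match w with Gen _ | GenMul _ _ => true | _ => false end.

Fixpoint normal w : bool :=
  match w with
  | Gen _ => true
  | GenMul _ w => normal w
  | Op u => normal u
  | OpMul u w => [&& normal u, normal w & starts_gen w]
  end.

Fixpoint wsize w : nat :=
  match w with
  | Gen _ => 1
  | GenMul _ w => (wsize w).+1
  | Op u => (wsize u).+1
  | OpMul u w => (wsize u + wsize w).+1
  end.

Lemma wsize_gt0 w : (0 < wsize w)%N.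
Proof. by case: w. Qed.

Section Eval.
Variables (K : fieldType) (B : rbAlgType K) (g : I -> B).

Fixpoint rbeval w : B :=
  match w with
  | Gen i => g i
  | GenMul i w => g i ** rbeval w
  | Op u => rbop (rbeval u)
  | OpMul u w => rbop (rbeval u) ** rbeval w
  end.

(* Induction on the size of the two words: rewriting R(p)R(q) with the
   Rota-Baxter relation only involves products of words of smaller total
   size. *)
Lemma lspan_rbeval_mul u v : normal u -> normal v ->
  lspan (fun w => normal w && (starts_gen u ==> starts_gen w)) rbeval
    (rbeval u ** rbeval v).
Proof.
have [n] := ubnP (wsize u + wsize v).
elim: n => // n IHn in u v *; rewrite ltnS => le_n.
have lin_l (a : B) : linear (amul a).
  by move=> c x y; rewrite amulDr amulZr.
have lin_r (b : B) : linear (amul^~ b).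
  by move=> c x y; rewrite amulDl amulZl.
have spanM p q : normal p -> normal q -> (wsize p + wsize q < n)%N ->
    lspan normal rbeval (rbeval p ** rbeval q).
  move=> Np Nq lt_pq; apply: lspanS (IHn _ _ lt_pq Np Nq).
  by move=> w /andP[].
(* The summands R(p)q and pR(q) carry one R more than pq, whence the [+ 1] in the size bound. *)
have spanR p q : normal p -> normal q -> (wsize p + wsize q + 1 < n)%N ->
    exists2 a, lspan normal rbeval a &
      rbop (rbeval p) ** rbop (rbeval q) = rbop a.
  move=> Np Nq lt_pq; rewrite rbopM; eexists; last by [].
  apply: lspanD; first apply: lspanD.
  - by apply: (spanM (Op p)) => //=; lia.
  - by apply: (spanM p (Op q)) => //=; lia.
  - by apply: spanM => //; lia.
case: u le_n => [i|i u|p|p u] /= le_n.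
- by move=> _ Nv; apply: (@lspan_gen _ _ _ _ _ (GenMul i v)); rewrite /= Nv.
- move=> Nu Nv; rewrite -amulA.
  apply: (lspan_map (lin_l _) _ (spanM u v Nu Nv _)); last by lia.
  by move=> w Nw; apply: (@lspan_gen _ _ _ _ _ (GenMul i w)); rewrite /= Nw.
- move=> Np; case: v le_n => [i|i v|q|q v] /= le_n.
  + by move=> _; apply: (@lspan_gen _ _ _ _ _ (OpMul p (Gen i))); rewrite /= Np.
  + by move=> Nv; apply: (@lspan_gen _ _ _ _ _ (OpMul p (GenMul i v)));
      rewrite /= Np Nv.
  + move=> Nq; have [|a Sa ->] := spanR p q Np Nq; first by lia.
    apply: (lspan_map (@rbop_linear _ _) _ Sa) => w Nw.
    by apply: (@lspan_gen _ _ _ _ _ (Op w)); rewrite /= Nw.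
  (* R(p)R(q) becomes R(a), and [v] starts with a generator, so each R(w)v is again normal. *)
  + move=> /and3P[Nq Nv Gv]; rewrite amulA.
    have [|a Sa ->] := spanR p q Np Nq; first by have := wsize_gt0 v; lia.
    have lin : linear (fun a => rbop a ** rbeval v).
      by move=> c x y; rewrite rbop_linear lin_r.
    apply: (lspan_map lin _ Sa) => w Nw.
    by apply: (@lspan_gen _ _ _ _ _ (OpMul w v)); rewrite /= Nw Nv Gv.
(* Here the clause on [starts_gen] is needed: [u] starts with a generator, hence so do all words in
   the expansion of uv, and R(p) can be put in front of them. *)
- move=> /and3P[Np Nu Gu] Nv; rewrite -amulA.
  have lt_uv : (wsize u + wsize v < n)%N by lia.
  apply: (lspan_map (lin_l _) _ (IHn u v lt_uv Nu Nv)) => w.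
  rewrite Gu => /andP[Nw /= Gw].
  by apply: (@lspan_gen _ _ _ _ _ (OpMul p w)); rewrite /= Np Nw Gw.
Qed.

Lemma lspan_rbeval_closed : rb_closed (lspan normal rbeval).
Proof.
split=> [|c a b Sa Sb|a b Sa Sb|a Sa].
- exact: lspan0.
- by apply: lspanD => //; exact: lspanZ.
- apply: (lspan_map (f := amul^~ b) _ _ Sa) => [c x y|u Nu].
    by rewrite amulDl amulZl.
  apply: (lspan_map (f := amul (rbeval u)) _ _ Sb) => [c x y|v Nv].
    by rewrite amulDr amulZr.
  by apply: lspanS (lspan_rbeval_mul Nu Nv) => w /andP[].
- apply: (lspan_map (@rbop_linear _ _) _ Sa) => w Nw.
  exact: (@lspan_gen _ _ _ _ _ (Op w)).
Qed.

End Eval.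

Lemma rbeval_morph (K : fieldType) (A B : rbAlgType K) (f : A -> B)
    (g : I -> A) w :
  rb_morphism f -> f (rbeval g w) = rbeval (f \o g) w.
Proof.
case=> _ fM fR.
by elim: w => //= [i w IHw|u IHu|u IHu w IHw]; rewrite ?fM ?fR ?IHw ?IHu.
Qed.

End Words.

(** * Freeness from the linear independence of normal words *)

Section FreeFromIndependence.
Variables (K : fieldType) (A : rbAlgType K) (I : Type) (x : I -> A).

Hypothesis indep : forall (s : seq (rbword I)) (c : rbword I -> K),
  uniq s -> {in s, forall w, normal w} ->
  \sum_(w <- s) c w *: rbeval x w = 0 -> {in s, forall w, c w = 0}.

Variables (B : rbAlgType K) (b : I -> B).

Let P : rbAlgType K := (A * B)%type.
Let xb (i : I) : P := (x i, b i).

Let graph : set P := lspan (@normal I) (rbeval xb).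

Let graph_closed : rb_closed graph := lspan_rbeval_closed xb.

(** The first component of a combination of pairs is the same combination of values in [A], so
    independence kills every coefficient. *)
Lemma graph_functional (p : P) : graph p -> p.1 = 0 -> p.2 = 0.
Proof.
move=> /lspan_sum[s [c [us Ns ->]]].
rewrite (raddf_sum (fst : P -> A)) => sum0.
rewrite big_seq big1 // => w ws.
rewrite (indep us Ns _ ws) ?scale0r // -[RHS]sum0; apply: eq_bigr => v _.
by rewrite /= (rbeval_morph _ _ (rb_morphism_fst A B)).
Qed.

Lemma graph_total a : rb_generated (range x) a -> exists y : B, graph (a, y).
Proof.
have [G0 GL GM GR] := graph_closed.
apply: (smallest_sub (X := [set a | exists y, graph (a, y)])).
  split=> [|c a1 a2 [y1 G1] [y2 G2]|a1 a2 [y1 G1] [y2 G2]|a1 [y1 G1]].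
  - by exists 0.
  - by exists (c *: y1 + y2); exact: (GL c _ _ G1 G2).
  - by exists (y1 ** y2); exact: (GM _ _ G1 G2).
  - by exists (rbop y1); exact: (GR _ G1).
move=> _ [i _ <-]; exists (b i).
exact: (@lspan_gen _ _ _ (rbeval xb) _ (Gen i)).
Qed.

Lemma graph_unique a y z : graph (a, y) -> graph (a, z) -> y = z.
Proof.
move=> Gy Gz; have [_ GL _ _] := graph_closed.
apply/eqP; rewrite -subr_eq0 addrC -scaleN1r; apply/eqP.
have G := GL (-1) _ _ Gz Gy.
by have /= := graph_functional G; apply; rewrite /= scaleN1r addNr.
Qed.

Lemma rb_subalg_morphism_exists :
  exists! f : rb_subalg x -> B,
    rb_morphism f /\ (forall i, f (rb_subalg_gen x i) = b i).
Proof.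
have [G0 GL GM GR] := graph_closed.
pose f (u : rb_subalg x) := projT1 (cid (graph_total (set_mem (valP u)))).
have Gf u : graph (\val u, f u) by rewrite /f; case: cid.
have fE u y : graph (\val u, y) -> f u = y by exact: graph_unique.
exists f; split.
  split; first split.
  - by move=> c u v; apply: fE; rewrite linearP; exact: (GL c _ _ (Gf u) (Gf v)).
  - by move=> u v; apply: fE; exact: (GM _ _ (Gf u) (Gf v)).
  - by move=> u; apply: fE; exact: (GR _ (Gf u)).
  - by move=> i; apply: fE; exact: (@lspan_gen _ _ _ (rbeval xb) _ (Gen i)).
move=> h [[h_lin hM hR] hg]; apply/funext => u.
have h0 := linear_pred0 h_lin.
(* The graph of any competitor [h] lies in [graph]: the elements of [A] where this holds form a
   closed set containing the generators. Stating it through [v] turns it into a predicate on [A], to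
   which minimality of the generated subalgebra applies. *)
suff: exists2 v, \val v = \val u & graph (\val v, h v).
  by case=> v /val_inj ->; exact: fE.
pose T := [set a | exists2 v : rb_subalg x, \val v = a & graph (\val v, h v)].
apply: (smallest_sub (X := T)) (set_mem (valP u)).
  split=> [|c _ _ [v <- Gv] [w <- Gw]|_ _ [v <- Gv] [w <- Gw]|_ [v <- Gv]].
  - by exists 0; rewrite ?raddf0 // h0.
  - exists (c *: v + w); rewrite ?linearP // h_lin.
    exact: (GL c _ _ Gv Gw).
  - by exists (v ** w) => //; rewrite hM; exact: (GM _ _ Gv Gw).
  - by exists (rbop v) => //; rewrite hR; exact: (GR _ Gv).
move=> _ [i _ <-]; exists (rb_subalg_gen x i) => //; rewrite hg.
exact: (@lspan_gen _ _ _ (rbeval xb) _ (Gen i)).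
Qed.

End FreeFromIndependence.

(** * Linear independence of normal words in the algebra of sequences *)

Lemma eq_cat_break (T : Type) (P : pred T) (s1 s2 : seq T) a b t1 t2 :
  all P s1 -> all P s2 -> ~~ P a -> ~~ P b ->
  s1 ++ a :: t1 = s2 ++ b :: t2 -> s1 = s2 /\ a :: t1 = b :: t2.
Proof.
move=> + + Pa Pb.
elim: s1 s2 => [|c s1 IH] [|d s2] //=.
- by move=> _ /andP[Pd _] [ad]; rewrite ad Pd in Pa.
- by move=> /andP[Pc _] _ [cb]; rewrite -cb Pc in Pb.
- by move=> /andP[_ P1] /andP[_ P2] [-> /(IH _ P1 P2)[-> ->]].
Qed.

Section Independence.
Variables (K : fieldType) (V : choiceType) (I : Type).
(** An abstract alphabet covering both cases of the theorem: [index] recovers the position of a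
    letter in its sequence, [colour] the generator it belongs to. *)
Variables (letter : I -> nat -> V) (index : V -> nat) (colour : V -> I).
Hypothesis indexK : forall i k, index (letter i k) = k.
Hypothesis colourK : forall i k, colour (letter i k) = i.

Implicit Types (w u : rbword I) (m : {fmonom V}) (p q : freealg K V).

Definition weight (s : seq V) : nat := sumn (map index s).

Lemma weight_cat s t : weight (s ++ t) = (weight s + weight t)%N.
Proof. by rewrite /weight map_cat sumn_cat. Qed.

Definition lower (d : nat) p : Prop :=
  forall m, (d <= weight m)%N -> mcoeff m p = 0.

Lemma lower0 d : lower d 0.
Proof. by move=> m _; exact: mcoeff0. Qed.

Lemma lowerD d p q : lower d p -> lower d q -> lower d (p + q).
Proof. by move=> lp lq m dm; rewrite mcoeffD lp // lq // addr0. Qed.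

Lemma lowerW d d' p : (d <= d')%N -> lower d p -> lower d' p.
Proof. by move=> dd' lp m d'm; apply: lp; exact: leq_trans d'm. Qed.

Lemma lower_monom s : lower (weight s).+1 (<< FMonom s >> : freealg K V).
Proof.
move=> m ltm; rewrite mcoeffU1; case: eqP => // E.
by rewrite -E ltnn in ltm.
Qed.

(** The bounds are strict: weights at most d - 1 and d' - 1 add up to at most d + d' - 2. *)
Lemma lowerM d d' p q : lower d p -> lower d' q -> lower (d + d').-1 (p * q).
Proof.
move=> lp lq m ltm; rewrite mcoeffMl big1 // => m1 _; rewrite big1 // => m2 _.
case: eqP => // E; rewrite mulr1n.
have [/lp ->|lt1] := leqP d (weight m1); first by rewrite mul0r.
have [/lq ->|lt2] := leqP d' (weight m2); first by rewrite mulr0.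
by move: ltm; rewrite -E fmM weight_cat; lia.
Qed.

Lemma monomM (s t : seq V) :
  (<< FMonom s >> : freealg K V) * << FMonom t >> = << FMonom (s ++ t) >>.
Proof.
rewrite [LHS](fgmulUU (1 : K) 1 (FMonom s) (FMonom t)) mulr1.
by congr (<< _ >>); apply/val_inj; rewrite /= fmM.
Qed.

Definition letter_seq (i : I) : rbseq (freealg K V) :=
  fun k => freealg_var K (letter i k).

(* The value of [w] at level [k] is a sum over labellings of the letters of
   [w] that decrease strictly along brackets; [top w k] is the pointwise
   largest one, and it exists when [k] is at least [height w]. *)
Fixpoint height w : nat :=
  match w with
  | Gen _ => 0
  | GenMul _ w => height w
  | Op u => (height u).+1
  | OpMul u w => maxn (height u).+1 (height w)
  end.

Fixpoint top w (k : nat) : seq V :=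
  match w with
  | Gen i => [:: letter i k]
  | GenMul i w => letter i k :: top w k
  | Op u => top u k.-1
  | OpMul u w => top u k.-1 ++ top w k
  end.

Lemma top_nonempty w k : exists a t, top w k = a :: t.
Proof.
elim: w k => /= [i|i w _|u IHu|u IHu w _] k; try by do 2!eexists.
  exact: IHu.
by have [a [t ->]] := IHu k.-1; do 2!eexists.
Qed.

Lemma top_le w k : all (fun a => index a <= k)%N (top w k).
Proof.
elim: w k => /= [i|i w IHw|u IHu|u IHu w IHw] k.
- by rewrite indexK leqnn.
- by rewrite indexK leqnn IHw.
- by apply: sub_all (IHu k.-1) => a; lia.
- by rewrite all_cat IHw andbT; apply: sub_all (IHu k.-1) => a; lia.
Qed.

Lemma top_lt u k : (0 < k)%N -> all (fun a => index a < k)%N (top u k.-1).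
Proof. by move=> k0; apply: sub_all (top_le u k.-1) => a; lia. Qed.

Lemma top_starts_gen w k : starts_gen w ->
  exists a t, top w k = a :: t /\ index a = k.
Proof.
by case: w => //= [i|i w] _; do 2!eexists; split; [|exact: indexK| |exact: indexK].
Qed.

Lemma top_starts_op w k : ~~ starts_gen w -> (height w <= k)%N ->
  exists a t, top w k = a :: t /\ (index a < k)%N.
Proof.
case: w => //= u => [_ hk|w _ hk]; have [a [t E]] := top_nonempty u k.-1;
  have := top_lt u (k := k); rewrite E => /(_ ltac:(lia)) /= /andP[lt_a _].
- by exists a, t.
- by exists a, (t ++ top w k).
Qed.

(** The first letter decides: its index is k after a generator and below k after an R. In the latter
    case the height bound forces k > 0, so [k.-1] is not truncated. *)
Lemma top_eq_starts_gen w w' k : (height w <= k)%N -> (height w' <= k)%N ->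
  top w k = top w' k -> starts_gen w = starts_gen w'.
Proof.
have aux v v' : (height v' <= k)%N -> top v k = top v' k ->
    starts_gen v -> starts_gen v'.
  move=> hv' E Gv; apply/negPn/negP => Gv'.
  have [a [t [Ea ak]]] := top_starts_gen k Gv.
  have [b [t' [Eb bk]]] := top_starts_op Gv' hv'.
  by move: bk; rewrite E Eb in Ea; case: Ea => -> _; rewrite ak ltnn.
by move=> hw hw' E; apply/idP/idP; exact: aux.
Qed.

(** The factor [w] contributes a letter of index k, whereas everything under the single R of [Op v]
    has index below k. *)
Lemma top_op_mul_neq u w v k : normal (OpMul u w) -> (0 < k)%N ->
  top (OpMul u w) k <> top (Op v) k.
Proof.
move=> /and3P[_ _ Gw] k0 E.
have := top_lt v k0; rewrite -[top v _]E /= all_cat.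
by have [a [t [-> ak]]] := top_starts_gen k Gw; rewrite /= ak ltnn andbF.
Qed.

Lemma top_inj w w' k : normal w -> normal w' ->
  (height w <= k)%N -> (height w' <= k)%N -> top w k = top w' k -> w = w'.
Proof.
have letter_inj j i i' : letter i j = letter i' j -> i = i'.
  by move=> /(congr1 colour); rewrite !colourK.
elim: w w' k => [i|i w IHw|u IHu|u IHu w IHw] w' k Nw Nw' hw hw' E;
  have := top_eq_starts_gen hw hw' E; case: w' Nw' hw' E => [j|j v|v|v v'] //=.
- by move=> _ _ [/letter_inj->].
- by move=> _ _ [_]; have [a [t ->]] := top_nonempty v k.
- by move=> _ _ [_]; have [a [t ->]] := top_nonempty w k.
- by move=> Nv hv [/letter_inj-> /(IHw _ _ Nw Nv hw hv)->].
- by move=> Nv hv E _; congr Op; apply: (IHu _ k.-1) => //=; move: hw => /=; lia.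
- by move=> Nv hv /esym /(top_op_mul_neq Nv); case; lia.
- by move=> Nv hv /(top_op_mul_neq Nw); case; lia.
move=> /and3P[Nv Nv' Gv'] hv E _.
have /and3P[Nu Nw1 Gw] := Nw.
move: hw hv => /=; rewrite !geq_max => /andP[hu hw] /andP[hv hv'].
have k0 : (0 < k)%N by lia.
have [a [t [Ea ak]]] := top_starts_gen k Gw.
have [b [t' [Eb bk]]] := top_starts_gen k Gv'.
(* Cutting both monomials at their first letter of index k separates the content of the leading R
   from the word after it. *)
have := E; rewrite Ea Eb => /(eq_cat_break (P := fun a => index a < k)%N).
rewrite !top_lt // ak bk ltnn -Ea -Eb => /(_ isT isT isT isT)[E1 E2].
have hu' : (height u <= k.-1)%N by rewrite -ltnS prednK.
have hv1 : (height v <= k.-1)%N by rewrite -ltnS prednK.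
by rewrite (IHu v k.-1 Nu Nv hu' hv1 E1) (IHw v' k Nw1 Nv' hw hv' E2).
Qed.

(** From level [height w] on, no predecessor is truncated, so passing from j to k raises the index
    of each letter by k - j, and there is at least one letter. *)
Lemma weight_top_lt w j k : (height w <= j)%N -> (j < k)%N ->
  (weight (top w j) < weight (top w k))%N.
Proof.
elim: w j k => /= [i|i w IHw|u IHu|u IHu w IHw] j k hj jk.
- by rewrite /weight /= !indexK; lia.
- by have := IHw j k hj jk; rewrite /weight /= !indexK; lia.
- by apply: IHu; lia.
have := IHw j k; have := IHu j.-1 k.-1; rewrite !weight_cat; lia.
Qed.

(** Each nested R delays the first nonzero entry by one level, since R sums over strictly smaller
    levels only. *)
Lemma rbeval_lt_height w k : (k < height w)%N -> rbeval letter_seq w k = 0.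
Proof.
elim: w k => //= [i w IHw|u IHu|u IHu w IHw] k.
- by move=> hk; rewrite /amul /= /rbseq_mul IHw ?mulr0.
- by move=> hk; rewrite /rbop /= /rbseq_op big1 // => j _; apply: IHu; case: j => /=; lia.
rewrite leq_max => /orP[hk|hk]; rewrite /amul /= /rbseq_mul.
  by rewrite [X in X * _]big1 ?mul0r // => j _; apply: IHu; case: j => /=; lia.
by rewrite IHw ?mulr0.
Qed.

(** One condition encodes two facts: the monomial has coefficient 1, and all other monomials have
    strictly smaller weight. *)
Definition leads (s : seq V) p : Prop :=
  lower (weight s) (p - (<< FMonom s >> : freealg K V)).

Lemma leads_lower s p : leads s p -> lower (weight s).+1 p.
Proof.
move=> lp; rewrite -[p](subrK (<< FMonom s >> : freealg K V)).
by apply: lowerD; [exact: lowerW lp | exact: lower_monom].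
Qed.

Lemma leads_monom s : leads s (<< FMonom s >> : freealg K V).
Proof. by rewrite /leads subrr; exact: lower0. Qed.

Lemma leads_letter i k : leads [:: letter i k] (letter_seq i k).
Proof. by rewrite /letter_seq /freealg_var fmuE; exact: leads_monom. Qed.

Lemma leadsM s t p q : leads s p -> leads t q -> leads (s ++ t) (p * q).
Proof.
move=> lp lq; rewrite /leads weight_cat -monomM.
set a : freealg K V := << FMonom s >>; set b : freealg K V := << FMonom t >>.
(* In each summand one factor is a remainder of strictly smaller weight, so the product stays below
   the weight of [s ++ t]. *)
have -> : p * q - a * b = (p - a) * q + a * (q - b).
  by rewrite mulrBl mulrBr addrA subrK.
apply: lowerD; first by have := lowerM lp (leads_lower lq); rewrite addnS.
exact: (lowerM (@lower_monom s) lq).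
Qed.

Lemma leads_coeff s p : leads s p -> mcoeff (FMonom s) p = 1.
Proof.
move=> /(_ (FMonom s) (leqnn _)) /eqP.
by rewrite mcoeffB mcoeffU1 eqxx subr_eq0 => /eqP.
Qed.

Lemma leads_coeff0 s p m : leads s p -> (weight s <= weight m)%N ->
  FMonom s != m -> mcoeff m p = 0.
Proof.
move=> lp le_sm /negPf sm.
by have /eqP := lp m le_sm; rewrite mcoeffB mcoeffU1 sm subr0 => /eqP.
Qed.

Lemma rbeval_leads w k : (height w <= k)%N ->
  leads (top w k) (rbeval letter_seq w k).
Proof.
have leads_op u l : (forall j, (height u <= j)%N ->
      leads (top u j) (rbeval letter_seq u j)) ->
    (height u < l)%N -> leads (top u l.-1) (rbop (rbeval letter_seq u) l).
  move=> IHu; case: l => // l hu.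
  (* The last summand of R supplies the leading monomial; each earlier one vanishes below the height
     of [u] or is lighter by [weight_top_lt]. *)
  rewrite /leads /rbop /= /rbseq_op big_ord_recr /= -addrA.
  apply: lowerD; last exact: IHu.
  apply: (big_ind (lower _)) => [|p q|j _]; [exact: lower0 | exact: lowerD |].
  have [hj|hj] := leqP (height u) j; last first.
    by rewrite rbeval_lt_height //; exact: lower0.
  by apply: lowerW (leads_lower (IHu j hj)); exact: weight_top_lt.
elim: w k => /= [i|i w IHw|u IHu|u IHu w IHw] k hk.
- exact: leads_letter.
- exact: (leadsM (@leads_letter i k) (IHw k hk)).
- exact: leads_op.
- move: hk; rewrite geq_max => /andP[hu hw].
  exact: (leadsM (leads_op u k IHu hu) (IHw k hw)).
Qed.

Lemma rbeval_free (s : seq (rbword I)) (c : rbword I -> K) :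
  uniq s -> {in s, forall w, normal w} ->
  \sum_(w <- s) c w *: rbeval letter_seq w = 0 -> {in s, forall w, c w = 0}.
Proof.
move=> us Ns sum0.
(* A common level at which every word of the family has its top monomial. *)
pose k := (\max_(w <- s) height w)%N.
have hk w : w \in s -> (height w <= k)%N by move=> ws; exact: leq_bigmax_seq.
pose N := (\max_(w <- s) weight (top w k))%N.
have hN w : w \in s -> (weight (top w k) <= N)%N.
  by move=> ws; exact: (@leq_bigmax_seq _ s xpredT (fun w => weight (top w k))).
have coeff0 m : \sum_(w <- s) c w * mcoeff m (rbeval letter_seq w k) = 0.
  have := congr1 (fun y : rbseq (freealg K V) => y k) sum0.
  rewrite /= (big_morph (fun y : rbseq (freealg K V) => y k)
    (id1 := 0) (op1 := +%R)) // => /(congr1 (mcoeff m)).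
  rewrite raddf_sum mcoeff0 => sumk; rewrite -[RHS]sumk.
  by apply: eq_bigr => w _; rewrite /= mcoeffZ.
(* Descending induction on the weight of the top monomial: the heaviest words come first. *)
move=> w; have [n] := ubnP (N - weight (top w k))%N.
elim: n w => // n IHn w lt_n ws.
have := coeff0 (FMonom (top w k)).
rewrite (bigD1_seq w) //= leads_coeff ?mulr1; last exact/rbeval_leads/hk.
rewrite big1_seq ?addr0 // => v /andP[vw vs].
(* In the coefficient at the top monomial of [w], heavier words already have coefficient zero; any
   other word could only contain this monomial as its own top one, which [top_inj] excludes. *)
have [lt_wv|le_vw] := ltnP (weight (top w k)) (weight (top v k)).
  by rewrite IHn ?mul0r //; have := hN v vs; lia.
rewrite (leads_coeff0 (rbeval_leads (hk v vs))) ?mulr0 //.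
apply: contra_neq vw => -[E].
by apply: (top_inj _ _ (hk v vs) (hk w ws) E); exact: Ns.
Qed.

Lemma rb_free_letter_seq : rb_free (rb_subalg_gen letter_seq).
Proof. by move=> B b; exact: (rb_subalg_morphism_exists rbeval_free b). Qed.

End Independence.

Theorem theorem4p1 (K : fieldType) (charK : [pchar K] =i pred0) :
  rb_free (rb_subalg_gen (fun _ : unit => alphabet K)) /\
  (forall n : nat, (1 <= n)%N -> rb_free (rb_subalg_gen (@alphabets K n))).
Proof.
split=> [|n _].
  by apply: (@rb_free_letter_seq K nat unit (fun _ k => k) id (fun=> tt)) => // -[].
exact: (@rb_free_letter_seq K _ 'I_n (fun i k => (i, k)) snd fst).
Qed.
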